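(* There are at most $2^{(1/4+o(1))n^2}$ multipermutation solutions of level $2$ of size $n$, up to isomorphism (where $o(1)$ is with respect to $n\to\infty$).
   Context: A solution is a triple $(X,\sigma,\tau)$ with $X$ a non-empty set and $\sigma,\tau\colon X\times X\to X$; its size is $|X|$. Write $\sigma_x=\sigma(x,\cdot)$, $\tau_y=\tau(\cdot,y)$ and $r(x,y)=(\sigma_x(y),\tau_y(x))$. It is required that: (braid relation) $(\mathrm{id}\times r)(r\times \mathrm{id})(\mathrm{id}\times r)=(r\times \mathrm{id})(\mathrm{id}\times r)(r\times \mathrm{id})$ on $X^3$; (non-degenerate) all $\sigma_x$ and $\tau_y$ are bijections of $X$; (involutive) $r^2=\mathrm{id}_{X^2}$. An isomorphism of solutions is a bijection commuting with both operations $\sigma$ and $\tau$. Retraction: define $x\sim y$ iff $\sigma_x=\sigma_y$. It is known that $\sigma,\tau$ induce well-defined operations on $X/\mathord{\sim}$, making it a solution $\mathrm{Ret}(X,\sigma,\tau)$, with $\overline\sigma([x],[y])=[\sigma(x,y)]$ and $\overline\tau([x],[y])=[\tau(x,y)]$. Put $\mathrm{Ret}^0(X,\sigma,\tau)=(X,\sigma,\tau)$ and $\mathrm{Ret}^k(X,\sigma,\tau)=\mathrm{Ret}(\mathrm{Ret}^{k-1}(X,\sigma,\tau))$ for $k\ge 1$. A solution is a multipermutation solution of level $m$ if $m$ is the least non-negative integer with $|\mathrm{Ret}^m(X,\sigma,\tau)|=1$. *)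

(* Defs.v *)
From mathcomp Require Import all_boot.
From mathcomp Require Import generic_quotient.
From mathcomp Require Import boolp.

Set Implicit Arguments.
Unset Strict Implicit.
Unset Printing Implicit Defensive.

Local Open Scope quotient_scope.

(* The laws are kept apart from the operations, so that [Ret] can be iterated
   without carrying proofs. *)
Record biop := Biop {
  carrier :> finType;
  sigma : carrier -> carrier -> carrier;
  tau : carrier -> carrier -> carrier
}.

(* [tau x y] is tau_y(x): the subscript is the second argument. *)
Definition rmap (S : biop) (p : S * S) : S * S :=
  (sigma p.1 p.2, tau p.1 p.2).

Definition r_id (S : biop) (v : S * S * S) : S * S * S :=
  (rmap (v.1.1, v.1.2), v.2).

Definition id_r (S : biop) (v : S * S * S) : S * S * S :=
  let q := rmap (v.1.2, v.2) in (v.1.1, q.1, q.2).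

Definition braided (S : biop) : Prop :=
  id_r (S := S) \o r_id (S := S) \o id_r (S := S)
    =1 r_id (S := S) \o id_r (S := S) \o r_id (S := S).

Definition nondegenerate (S : biop) : Prop :=
  (forall x : S, bijective (sigma x)) /\
  (forall y : S, bijective (fun x : S => tau x y)).

Record solution (S : biop) : Prop := Solution {
  sol_nonempty : 0 < #|S|;
  sol_braided : braided S;
  sol_nondegenerate : nondegenerate S;
  sol_involutive : involutive (@rmap S)
}.

Definition isomorphic (S T : biop) : Prop :=
  exists f : S -> T,
    [/\ bijective f,
        {morph f : x y / sigma x y >-> sigma x y} &
        {morph f : x y / tau x y >-> tau x y}].

Definition ret_rel (S : biop) : rel S :=
  fun x y => [forall z, sigma x z == sigma y z].

Lemma ret_relP (S : biop) (x y : S) : reflect (sigma x =1 sigma y) (ret_rel x y).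
Proof. exact: 'forall_eqP. Qed.

Lemma ret_rel_equiv (S : biop) : equiv_class_of (@ret_rel S).
Proof.
split=> [x|x y|y x z].
- exact/ret_relP.
- by apply/ret_relP/ret_relP => h z; rewrite h.
- by move=> /ret_relP h1 /ret_relP h2; apply/ret_relP => t; rewrite h1.
Qed.

Canonical ret_equiv (S : biop) := EquivRelPack (ret_rel_equiv S).

(* [quot_type] is the library's alias of a quotient with its finType structure. *)
Definition ret_carrier (S : biop) := quot_type {eq_quot (ret_equiv S)}.

(* The operations are computed on the canonical representatives; [ret_sigmaE]
   and [ret_tauE] below show that for a solution any representatives do. *)
Definition Ret (S : biop) : biop :=
  @Biop (ret_carrier S)
    (fun a b => \pi_(ret_carrier S) (sigma (repr a) (repr b)))
    (fun a b => \pi_(ret_carrier S) (tau (repr a) (repr b))).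

Definition multipermutation_level (m : nat) (S : biop) : Prop :=
  #|iter m Ret S| = 1 /\ forall k : nat, k < m -> #|iter k Ret S| <> 1.

Lemma pi_retP (S : biop) (x y : S) :
  \pi_(ret_carrier S) x = \pi_(ret_carrier S) y <-> sigma x =1 sigma y.
Proof. by split=> [/eqmodP/ret_relP|h] //; apply/eqmodP/ret_relP. Qed.

Section RetSolution.
Variables (S : biop) (solS : solution S).

Let pi (x : S) : Ret S := \pi_(ret_carrier S) x.

Let sigma_inj (x : S) : injective (sigma x).
Proof. exact/bij_inj/((sol_nondegenerate solS).1 x). Qed.

Let inv1 (x y : S) : sigma (sigma x y) (tau x y) = x.
Proof. by have [] := sol_involutive solS (x, y). Qed.

Let braid1 (x y z : S) :
  sigma x (sigma y z) = sigma (sigma x y) (sigma (tau x y) z).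
Proof. by have [] := sol_braided solS (x, y, z). Qed.

Let sigma_reflects (x y y' : S) :
  ret_rel (sigma x y) (sigma x y') -> ret_rel y y'.
Proof.
move=> /ret_relP h; apply/ret_relP => z; apply: (@sigma_inj x).
rewrite [LHS]braid1 [RHS]braid1 h; congr (sigma _ (sigma _ z)).
by apply: (@sigma_inj (sigma x y)); rewrite inv1 h inv1.
Qed.

Let sigma_preserves (x y y' : S) :
  ret_rel y y' -> ret_rel (sigma x y) (sigma x y').
Proof.
have [s sK Ks] := (sol_nondegenerate solS).1 x.
pose A := [set p : S * S | ret_rel p.1 p.2].
pose g (p : S * S) := (s p.1, s p.2).
have injg : injective g.
  by move=> [a b] [c d] [/(can_inj Ks)-> /(can_inj Ks)->].
have gA : g @: A = A.
  apply/eqP; rewrite eqEcard card_imset // leqnn andbT.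
  apply/subsetP => _ /imsetP[[a b] + ->]; rewrite !inE /= => hab.
  by apply: (@sigma_reflects x); rewrite !Ks.
move=> hy; have : (y, y') \in A by rewrite inE.
by rewrite -{1}gA => /imsetP[[a b]]; rewrite inE /= => hab [-> ->]; rewrite !Ks.
Qed.

Let sigma_compat (x x' y y' : S) : ret_rel x x' -> ret_rel y y' ->
  ret_rel (sigma x y) (sigma x' y').
Proof. by move=> /ret_relP hx hy; rewrite -hx; apply: sigma_preserves. Qed.

Let tau_compat (x x' y y' : S) : ret_rel x x' -> ret_rel y y' ->
  ret_rel (tau x y) (tau x' y').
Proof.
move=> hx hy; have /ret_relP h := sigma_compat hx hy.
by apply: (@sigma_reflects (sigma x y)); rewrite inv1 h inv1.
Qed.

Let ret_repr (x : S) : ret_rel (repr (pi x)) x.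
Proof. by apply/ret_relP/pi_retP; rewrite reprK. Qed.

Lemma ret_sigmaE (x y : S) : sigma (pi x) (pi y) = pi (sigma x y).
Proof. exact/pi_retP/ret_relP/sigma_compat. Qed.

Lemma ret_tauE (x y : S) : tau (pi x) (pi y) = pi (tau x y).
Proof. exact/pi_retP/ret_relP/tau_compat. Qed.

Let pi_surj (a : Ret S) : exists x, pi x = a.
Proof. by exists (repr a); rewrite /pi reprK. Qed.

Let surj_bij (f : Ret S -> Ret S) : (forall b, exists a, f a = b) -> bijective f.
Proof.
move=> f_surj; have [g gK] := choice f_surj.
exact: (bij_can_bij (injF_bij (can_inj gK)) gK).
Qed.

Let pi2 (p : S * S) : Ret S * Ret S := (pi p.1, pi p.2).
Let pi3 (v : S * S * S) : Ret S * Ret S * Ret S := (pi2 v.1, pi v.2).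

Let rmap_pi (p : S * S) : rmap (pi2 p) = pi2 (rmap p).
Proof. by congr pair; [apply: ret_sigmaE | apply: ret_tauE]. Qed.

Let r_id_pi (v : S * S * S) : r_id (pi3 v) = pi3 (r_id v).
Proof. by case: v => [[x y] z]; congr pair; apply: (rmap_pi (x, y)). Qed.

Let id_r_pi (v : S * S * S) : id_r (pi3 v) = pi3 (id_r v).
Proof.
case: v => [[x y] z]; congr (_, _, _).
- exact: (ret_sigmaE y z).
- exact: (ret_tauE y z).
Qed.

Lemma Ret_solution : solution (Ret S).
Proof.
have [/card_gt0P[x0 _] braidS [bijs bijt] invS] := solS.
split.
- by apply/card_gt0P; exists (pi x0).
- move=> [[a b] c].
  have [x <-] := pi_surj a; have [y <-] := pi_surj b; have [z <-] := pi_surj c.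
  rewrite -[(_, _, _)]/(pi3 (x, y, z)) /comp.
  by rewrite !(r_id_pi, id_r_pi); congr pi3; apply: braidS.
- split=> [a|b]; apply: surj_bij => c; have [z <-] := pi_surj c.
  + have [x <-] := pi_surj a; have [g _ gK] := bijs x.
    by exists (pi (g z)); rewrite ret_sigmaE gK.
  + have [y <-] := pi_surj b; have [g _ gK] := bijt y.
    by exists (pi (g z)); rewrite ret_tauE gK.
- move=> [a b]; have [x <-] := pi_surj a; have [y <-] := pi_surj b.
  by rewrite -[(_, _)]/(pi2 (x, y)) !rmap_pi invS.
Qed.

End RetSolution.

(* Up to relabelling, a solution of size n has carrier 'I_n. *)
Definition tables (n : nat) : finType :=
  ({ffun 'I_n -> {ffun 'I_n -> 'I_n}} * {ffun 'I_n -> {ffun 'I_n -> 'I_n}})%type.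

Definition biop_of (n : nat) (t : tables n) : biop :=
  @Biop 'I_n (fun x y => t.1 x y) (fun x y => t.2 x y).

Definition iso_tables (n : nat) : rel (tables n) :=
  fun s t => `[< isomorphic (biop_of s) (biop_of t) >].

Lemma iso_tables_equiv (n : nat) : equivalence_rel (@iso_tables n).
Proof.
have refl (S : biop) : isomorphic S S by exists id; split=> //; exists id.
have sym (S T : biop) : isomorphic S T -> isomorphic T S.
  move=> [f [[g fK gK] fs ft]]; exists g; split; first by exists f.
  - by move=> x y; apply: (can_inj fK); rewrite fs !gK.
  - by move=> x y; apply: (can_inj fK); rewrite ft !gK.
have trans (S T U : biop) : isomorphic S T -> isomorphic T U -> isomorphic S U.
  move=> [f [bf fs ft]] [g [bg gs gt]]; exists (g \o f).
  split; first exact: bij_comp.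
  - by move=> x y /=; rewrite fs gs.
  - by move=> x y /=; rewrite ft gt.
move=> s t u; split; first exact/asboolP.
move=> /asboolP st; apply/asboolP/asboolP; apply: trans => //.
exact: sym.
Qed.

Definition mp_tables (n m : nat) : {set tables n} :=
  [set t : tables n |
    `[< solution (biop_of t) /\ multipermutation_level m (biop_of t) >]].

Definition mp_count (n m : nat) : nat :=
  #|equivalence_partition (@iso_tables n) (mp_tables n m)|.

(* Main.v *)
Require Import Defs.
From mathcomp Require Import all_boot all_order all_fingroup all_algebra.
From mathcomp Require Import boolp zify.

(** Let [pi] be the permutation sigma_e for a fixed element [e], and set
    L_x = pi^-1 o sigma_x. For a solution of level 2 the permutations L_x
    commute with each other, and L_{L_x(y)} = L_y
    ([displacement_commute], [sigma_perm_displacement]). Moreover tau is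
    determined by sigma, and sigma by [pi] and L. So up to the n^n choices of
    [pi] it suffices to count the families L with these two properties.

    Let G be the abelian group generated by the L_x. The second property says
    that L is constant on the orbits of G. Choose a representative of each
    orbit. A permutation commuting with G is determined on an orbit by its value
    at the representative, so L is determined by the action of G together with
    the values L_x(y), where x and y run over the k representatives. The value
    L_x(y) lies in the orbit of y. If the orbits have sizes m_1, ..., m_k, there
    are (m_1 ... m_k)^k possibilities for these values, and m <= 2^(m-1) bounds
    this number by 2^(k(n-k)) <= 2^(n^2/4) ([prod_fibre_bound]).

    It remains to see that the action of G can be recorded cheaply. On each orbit
    some log_2 n elements of G already act transitively, because adding a
    generator that enlarges the orbit of a commutative group at least doubles it
    ([abelian_orbit_generators]). Assembling the i-th generators of all the
    orbits gives log_2 n self-maps of the carrier, hence n^(n log_2 n)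
    possibilities ([frame], [frame_exists]).

    The total is 2^(n^2/4 + O(n log^2 n)). All operation tables are counted here,
    without identifying the isomorphic ones. *)

Set Implicit Arguments.
Unset Strict Implicit.
Unset Printing Implicit Defensive.

(** * Generators of abelian orbits *)

(** Translation by [a] carries the one orbit onto the other. *)
Lemma card_orbit_commute (gT : finGroupType) (T : finType)
    (to : {action gT &-> T}) (H : {group gT}) (a : gT) (x : T) :
  (forall h, h \in H -> commute a h) -> #|orbit to H (to x a)| = #|orbit to H x|.
Proof.
move=> aH; rewrite -(card_setact to (orbit to H x) a); apply: eq_card => y.
apply/idP/imsetP => [/orbitP[h hH <-]|[_ /orbitP[h hH <-] ->]].
- by exists (to x h); rewrite ?mem_orbit // -!actM (aH h hH).
- by apply/orbitP; exists h; rewrite // -!actM (aH h hH).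
Qed.

(** Take [B] of maximal size among the subsets of [A] with
    2^#|B| <= #|orbit of <<B>>|. If some [a] in [A] moved [x] out of its orbit
    under <<B>>, the translate of that orbit by [a] would be another orbit of the
    same size, so that [a |: B] would be a larger such subset. *)
Lemma abelian_orbit_generators (gT : finGroupType) (T : finType)
    (to : {action gT &-> T}) (A : {set gT}) (x : T) :
  (forall a b, a \in A -> b \in A -> commute a b) ->
  exists2 B : {set gT}, B \subset A &
    orbit to <<B>> x = orbit to <<A>> x /\ 2 ^ #|B| <= #|orbit to <<A>> x|.
Proof.
move=> cA.
pose P (B : {set gT}) := (B \subset A) && (2 ^ #|B| <= #|orbit to <<B>> x|).
have P0 : P set0.
  by rewrite /P sub0set cards0; apply/card_gt0P; exists x; apply: orbit_refl.
case: (arg_maxnP (fun B : {set gT} => #|B|) P0) => B /andP[sBA leB] maxB.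
suff eqO : orbit to <<B>> x = orbit to <<A>> x by exists B; rewrite // -eqO.
apply/eqP; rewrite eqEsubset; apply/andP; split.
  apply/subsetP => _ /orbitP[b bB <-].
  by apply: mem_orbit; apply: (subsetP (genS sBA)).
have cAB a h : a \in A -> h \in <<B>>%g -> commute a h.
  move=> aA hB; have /cent1P : h \in 'C[a]%g.
    move: h hB; apply/subsetP; rewrite gen_subG.
    by apply/subsetP => b /(subsetP sBA) bA; apply/cent1P/cA.
  by [].
have stay a : a \in A -> to x a \in orbit to <<B>> x.
  move=> aA; apply: contraT => ax.
  have aB : a \notin B by apply: contra ax => aB; apply: mem_orbit; apply: mem_gen.
  suff PaB : P (a |: B) by have := maxB _ PaB; rewrite cardsU1 aB /= ltnn.
  rewrite /P subUset sub1set aA sBA /= cardsU1 aB expnS mul2n -addnn.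
  have /leq_trans : 2 ^ #|B| + 2 ^ #|B| <=
      #|orbit to <<B>> x :|: orbit to <<B>> (to x a)|.
    rewrite cardsU (_ : _ :&: _ = set0) ?cards0 ?subn0.
      by apply: leq_add; rewrite // card_orbit_commute // => h; apply: cAB.
    apply/eqP; apply: contraNT ax => /set0Pn[y /setIP[/orbit_eqP <- /orbit_eqP ->]].
    exact: orbit_refl.
  apply; apply/subset_leq_card/subsetP => y.
  have sBaB : <<B>>%g \subset <<a |: B>>%g by apply: genS; apply: subsetUr.
  case/setUP => /orbitP[b /(subsetP sBaB) bB <-]; first exact: mem_orbit.
  rewrite -actM; apply: mem_orbit; rewrite groupM // mem_gen //.
  by rewrite setU11.
suff acts : [acts <<A>>%g, on orbit to <<B>> x | to].
  by rewrite acts_sub_orbit // orbit_refl.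
rewrite gen_subG; apply/subsetP => a aA; rewrite !inE /=.
apply/subsetP => _ /orbitP[b bB <-]; rewrite inE -actM -(cAB a b aA bB) actM.
by rewrite -(orbit_eqP (stay a aA)) mem_orbit.
Qed.

(** * Commuting families of permutations *)

Section CommutingFamilies.
Variable T : finType.
Implicit Types (L : {ffun T -> {perm T}}) (t : {ffun T -> T}).

Definition commuting_family L : Prop :=
  (forall x y, commute (L x) (L y)) /\ (forall x y, L (L x y) = L y).

(** [t] sends a point to the representative of its orbit, and the self-maps
    [g k] stand for generators of the group generated by the [L x], chosen on
    every orbit separately. The last
    clause says that the representative reaches its whole orbit under the
    [g k]; phrasing it by closed sets makes [frame_inj] an induction on
    reachability. *)
Record frame m t (g : {ffun 'I_m -> {ffun T -> T}}) L : Prop := Frame {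
  frame_idem x : t (t x) = t x;
  frame_const x : L (t x) = L x;
  frame_stable x y : t (L x y) = t y;
  frame_comm k x y : g k (L x y) = L x (g k y);
  frame_gen y (E : {set T}) :
    t y \in E -> (forall k z, z \in E -> g k z \in E) -> y \in E
}.

Lemma frame_exists L : commuting_family L ->
  exists t, exists g : {ffun 'I_(trunc_log 2 #|T|) -> {ffun T -> T}}, frame t g L.
Proof.
move=> [cL LL]; pose A : {set {perm T}} := L @: [set: T].
have cA a b : a \in A -> b \in A -> commute a b.
  by move=> /imsetP[x _ ->] /imsetP[y _ ->].
have AL x : L x \in A by apply: imset_f; rewrite inE.
pose O := orbit 'P%act <<A>>%g.
pose t := [ffun x => odflt x [pick z in O x]].
have tO x : t x \in O x.
  rewrite ffunE; case: pickP => [z zO //|/(_ x)]; by rewrite orbit_refl.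
have tE x y : O x = O y -> t x = t y.
  move=> eO; rewrite !ffunE -eO; case: pickP => [z //|/(_ x)].
  by rewrite orbit_refl.
have Ot x : O (t x) = O x by apply/orbit_eqP; apply: tO.
have OL x y : O (L x y) = O y.
  by apply/orbit_eqP; apply: (mem_orbit 'P%act y); apply: mem_gen.
have constL x y : O x = O y -> L x = L y.
  move=> /orbit_eqP/orbitP[a aA <-].
  have : [acts <<A>>%g, on [set z | L z == L y] | 'P].
    rewrite gen_subG; apply/subsetP => _ /imsetP[u _ ->]; rewrite !inE /=.
    by apply/subsetP => z; rewrite !inE /= apermE LL.
  by move=> /acts_act/(_ a aA y); rewrite !inE eqxx => /eqP.
have [B BP] := choice (fun x =>
  let: ex_intro2 B sB P := abelian_orbit_generators 'P%act x cA in
  ex_intro (fun B : {set {perm T}} => B \subset A /\ _) B (conj sB P)).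
have sizeB x : #|B x| <= trunc_log 2 #|T|.
  have [_ [_ le2]] := BP x; apply: trunc_log_max => //.
  exact: leq_trans le2 (max_card _).
(* An orbit with fewer generators than indices is padded with the identity. *)
pose b (k : nat) x := nth 1%g (enum (B x)) k.
have bB k x : b k x \in 1%g |: B x.
  rewrite /b; have [le|lt] := leqP (size (enum (B x))) k.
    by rewrite nth_default // setU11.
  by rewrite in_setU -[X in _ || X]mem_enum mem_nth ?orbT.
have bA k x y : commute (b k x) (L y).
  case/setU1P: (bB k x) => [->|]; first exact/commute_sym/commute1.
  by move=> /(subsetP (BP x).1) ?; apply: cA.
exists t, [ffun k : 'I__ => [ffun y => b k (t y) y]].
have tt x : t (t x) = t x by apply: tE; apply: Ot.
have tL x y : t (L x y) = t y by apply: tE; apply: OL.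
clearbody t; split=> //.
- by move=> x; apply/constL/Ot.
- by move=> k x y; rewrite !ffunE tL -!permM bA.
- move=> y E tyE Egen.
  have Oy : y \in orbit 'P%act <<B (t y)>>%g (t y).
    by rewrite (BP _).2.1 -/(O (t y)) Ot orbit_refl.
  (* [g k] acts as the k-th element of [B (t y)] only on the orbit of [y], hence
     the intersection with that orbit. *)
  have act : [acts <<B (t y)>>%g, on E :&: [set z | t z == t y] | 'P].
    rewrite gen_subG; apply/subsetP => a aB; rewrite !inE /=.
    apply/subsetP => z /setIP[zE]; rewrite inE => /eqP tz; rewrite !inE /= apermE.
    have /imsetP[u _ au] := subsetP (BP _).1 a aB.
    apply/andP; split; last by rewrite au tL tz.
    have lt : index a (enum (B (t y))) < trunc_log 2 #|T|.
      by apply: leq_trans (sizeB (t y)); rewrite cardE index_mem mem_enum.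
    have := Egen (Ordinal lt) z zE; rewrite !ffunE tz /b /= nth_index //.
    by rewrite mem_enum.
  have := subsetP (_ : _ \subset E :&: [set z | t z == t y]) y Oy.
  by rewrite acts_sub_orbit // !inE tyE tt eqxx => /(_ isT)/andP[].
Qed.

(** The set where [L x] and [L' x] agree is closed under the [g k], since both
    permutations commute with them. *)
Lemma frame_inj m t (g : {ffun 'I_m -> {ffun T -> T}}) L L' :
  frame t g L -> frame t g L' ->
  (forall x y, t x = x -> t y = y -> L x y = L' x y) -> L = L'.
Proof.
move=> fL fL' eqL; apply/ffunP => x; apply/permP => y.
have tt := frame_idem fL; rewrite -(frame_const fL) -(frame_const fL').
have : y \in [set z | L (t x) z == L' (t x) z].
  apply: (frame_gen fL) => [|k z]; rewrite !inE; first by rewrite eqL.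
  by rewrite -(frame_comm fL) -(frame_comm fL') => /eqP->.
by rewrite inE => /eqP.
Qed.

(** With k fixed points and fibres of sizes m_1, ..., m_k, the product is
    (m_1 ... m_k)^k, while m_i <= 2^(m_i - 1) and the numbers m_i - 1 add up to
    #|T| - k. Finally k(#|T| - k) <= #|T|^2 / 4. *)
Lemma prod_fibre_bound t :
  (forall x, t (t x) = t x) ->
  \prod_(p : T * T | (t p.1 == p.1) && (t p.2 == p.2)) #|[set z | t z == p.2]|
    <= 2 ^ (#|T| ^ 2 %/ 4).
Proof.
move=> tt; pose R := [set x | t x == x].
have fib : \sum_(y in R) #|[set z | t z == y]| = #|T|.
  rewrite -[RHS]sum1_card [RHS](partition_big t (mem R)) /=; last first.
    by move=> x _; rewrite inE tt.
  by apply: eq_bigr => y _; rewrite -sum1_card; apply: eq_bigl => z; rewrite inE.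
have pos y : y \in R -> 0 < #|[set z | t z == y]|.
  by rewrite inE => ty; apply/card_gt0P; exists y; rewrite inE.
have : \prod_(p : T * T | (t p.1 == p.1) && (t p.2 == p.2)) #|[set z | t z == p.2]|
   = \prod_(x in R) \prod_(y in R) #|[set z | t z == y]|.
  by rewrite pair_big /=; apply: eq_bigl => p; rewrite !inE.
move=> ->; rewrite prod_nat_const.
have excess : \sum_(y in R) #|[set z | t z == y]|.-1 = #|T| - #|R|.
  rewrite -fib -[#|R|]sum1_card -sumnB; last by move=> y /pos.
  by apply: eq_bigr => y _; rewrite subn1.
have le2 : \prod_(y in R) #|[set z | t z == y]| <= 2 ^ (#|T| - #|R|).
  rewrite -excess expn_sum; apply: leq_prod => y /pos.
  by case: #|_| => // k _; apply: ltn_expl.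
have [->|R0] := posnP #|R|; first by rewrite expn_gt0.
apply: leq_trans (_ : (2 ^ (#|T| - #|R|)) ^ #|R| <= _); first by rewrite leq_exp2r.
rewrite -expnM leq_exp2l // leq_divRL // mulnC.
have leRT : #|R| <= #|T| by apply: max_card.
by have [] := nat_AGM2 (#|T| - #|R|) #|R|; rewrite subnK.
Qed.

(** The values L_x(y) at representatives x and y determine [L], and each lies in
    the orbit of y. *)
Lemma card_frame m t (g : {ffun 'I_m -> {ffun T -> T}}) :
  #|[set L | `[< frame t g L >]]| <= 2 ^ (#|T| ^ 2 %/ 4).
Proof.
have [->|[L0]] := set_0Vmem [set L | `[< frame t g L >]]; first by rewrite cards0.
rewrite inE => /asboolP /frame_idem tt; apply: leq_trans (prod_fibre_bound tt).
pose rep (p : T * T) := (t p.1 == p.1) && (t p.2 == p.2).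
(* Away from the pairs of representatives the code takes a fixed value, so these
   positions contribute factors 1 to the product. *)
pose code L := [ffun p : T * T => if rep p then L p.1 p.2 else p.2].
pose F p : {set T} := if rep p then [set z | t z == p.2] else [set p.2].
rewrite -(card_in_imset (f := code)); last first.
  move=> L L'; rewrite !inE => /asboolP fL /asboolP fL' eqc.
  apply: (frame_inj fL fL') => x y tx ty; move/ffunP/(_ (x, y)): eqc.
  by rewrite !ffunE /rep /= tx ty !eqxx.
rewrite big_mkcond; apply: leq_trans (_ : #|family F| <= _); last first.
  rewrite card_family foldrE big_map big_enum /=; apply: leq_prod => p _.
  by rewrite /F /rep; case: ifP; rewrite ?cards1.
apply/subset_leq_card/subsetP => _ /imsetP[L + ->]; rewrite inE => /asboolP fL.
apply/familyP => p; rewrite ffunE /F; case: ifP => [/andP[_ /eqP t2]|_].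
  by rewrite inE (frame_stable fL) t2.
by rewrite inE.
Qed.

Lemma card_bigcup_leq (I U : finType) (F : I -> {set U}) k :
  (forall i, #|F i| <= k) -> #|\bigcup_i F i| <= #|I| * k.
Proof.
move=> Fk; rewrite -sum_nat_const.
elim/big_rec2: _ => [|i n A _ leA]; first by rewrite cards0.
by rewrite (leq_trans (leq_card_setU _ _)) // leq_add.
Qed.

Lemma card_commuting_family :
  #|[set L | `[< commuting_family L >]]|
    <= #|T| ^ (#|T| * (trunc_log 2 #|T|).+1) * 2 ^ (#|T| ^ 2 %/ 4).
Proof.
pose m := trunc_log 2 #|T|.
pose I : finType := ({ffun T -> T} * {ffun 'I_m -> {ffun T -> T}})%type.
have cardI : #|I| = #|T| ^ (#|T| * m.+1).
  by rewrite card_prod !card_ffun card_ord -expnM -expnD mulnS.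
rewrite -cardI.
pose F (i : I) := [set L | `[< frame i.1 i.2 L >]].
apply: leq_trans (card_bigcup_leq (F := F) (fun i => card_frame i.1 i.2)).
apply/subset_leq_card/subsetP => L; rewrite inE => /asboolP /frame_exists[t [g fL]].
by apply/bigcupP; exists (t, g); rewrite // inE; apply/asboolP.
Qed.

End CommutingFamilies.

(** * Displacements of a solution of level 2 *)

Section LevelTwo.
Variables (S : biop) (solS : solution S) (ret2 : #|Ret (Ret S)| = 1).
Implicit Types x y z e : S.

Let sigma_inj x : injective (sigma x).
Proof. exact/bij_inj/((sol_nondegenerate solS).1 x). Qed.

Definition sigma_perm x : {perm S} := perm (@sigma_inj x).

Lemma sigma_permE x y : sigma_perm x y = sigma x y.
Proof. exact: permE. Qed.

Lemma sigma_perm_eq x y : sigma x =1 sigma y <-> sigma_perm x = sigma_perm y.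
Proof.
split=> [eqs|eqs z]; last by rewrite -!sigma_permE eqs.
by apply/permP => z; rewrite !sigma_permE.
Qed.

Lemma involutive_tau x y : sigma (sigma x y) (tau x y) = x.
Proof. by have [] := sol_involutive solS (x, y). Qed.

Lemma braided_sigma_perm x y :
  (sigma_perm y * sigma_perm x =
   sigma_perm (tau x y) * sigma_perm (sigma x y))%g.
Proof.
apply/permP => z; rewrite !permM !sigma_permE.
by have [] := sol_braided solS (x, y, z).
Qed.

(** The second retract is a point, so all the maps sigma of [Ret S] coincide. *)
Lemma sigma_perm_sigma x x' y :
  sigma_perm (sigma x y) = sigma_perm (sigma x' y).
Proof.
apply/sigma_perm_eq/pi_retP; rewrite -!(ret_sigmaE solS).
by apply: (proj1 (pi_retP (S := Ret S) _ _)); apply: fintype_le1P; rewrite ret2.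
Qed.

(** Injectivity of the maps sigma of the retract, read in [S]. *)
Lemma sigma_perm_reflect x y y' :
  sigma_perm (sigma x y) = sigma_perm (sigma x y') -> sigma_perm y = sigma_perm y'.
Proof.
move=> /sigma_perm_eq/pi_retP; rewrite -!(ret_sigmaE solS) => eqR.
apply/sigma_perm_eq/pi_retP; move: eqR; apply: bij_inj.
exact: (sol_nondegenerate (Ret_solution solS)).1.
Qed.

Definition displacement e x : {perm S} := (sigma_perm x * (sigma_perm e)^-1)%g.

Lemma sigma_displacement e x y : sigma e (displacement e x y) = sigma x y.
Proof. by rewrite permM -[LHS]sigma_permE permKV sigma_permE. Qed.

Lemma sigma_perm_displacement e x y :
  sigma_perm (displacement e x y) = sigma_perm y.
Proof.
by apply: (@sigma_perm_reflect e); rewrite sigma_displacement; apply: sigma_perm_sigma.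
Qed.

(** This is the braid relation for the pair (sigma_e(x), y), read modulo the
    relation a ~ b iff sigma_a = sigma_b. Let (u, v) be its image under r. Since
    ~-classes are permuted by all maps sigma in the same way, u ~ sigma_e(y);
    and involutivity, sigma_u(v) = sigma_e(x), gives v ~ x. *)
Lemma sigma_perm_swap e x y :
  (sigma_perm y * sigma_perm (sigma e x) = sigma_perm x * sigma_perm (sigma e y))%g.
Proof.
rewrite braided_sigma_perm (sigma_perm_sigma _ e); congr (_ * _)%g.
apply: (@sigma_perm_reflect e).
by rewrite (sigma_perm_sigma e (sigma (sigma e x) y)) involutive_tau.
Qed.

(** [sigma_perm_swap] with [y := e] gives sigma_{sigma_e(z)} = c o sigma_z o
    sigma_e^-1 for a permutation c independent of z. Substituting this into
    [sigma_perm_swap] and cancelling c leaves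
    sigma_x o sigma_e^-1 o sigma_y = sigma_y o sigma_e^-1 o sigma_x. *)
Lemma displacement_commute e x y :
  commute (displacement e x) (displacement e y).
Proof.
have [c raise] : exists c, forall z,
    sigma_perm (sigma e z) = ((sigma_perm e)^-1 * sigma_perm z * c)%g.
  by exists (sigma_perm (sigma e e)) => z; rewrite -mulgA -sigma_perm_swap mulKg.
have := sigma_perm_swap e y x; rewrite !raise !mulgA => /mulIg eqxy.
by rewrite /commute /displacement !mulgA eqxy.
Qed.

End LevelTwo.

(** * Counting the operation tables *)

Lemma mp_count_le n m : mp_count n m <= #|mp_tables n m|.
Proof. exact: leq_imset_card. Qed.

Lemma mp_tables2_empty : mp_tables 0 2 = set0.
Proof.
apply/setP => t; rewrite !inE; apply/asboolP => -[solS _].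
by have := sol_nonempty solS; rewrite card_ord.
Qed.

Lemma card_mp_tables2 n :
  #|mp_tables n 2| <= n ^ n * (n ^ (n * (trunc_log 2 n).+1) * 2 ^ (n ^ 2 %/ 4)).
Proof.
case: n => [|n]; first by rewrite mp_tables2_empty cards0.
set N := n.+1; pose D := {ffun 'I_N -> {perm 'I_N}}.
have dec (s : tables N) : s \in mp_tables N 2 -> exists L : D,
    commuting_family L /\ forall x y, s.1 x y = s.1 ord0 (L x y).
  rewrite inE => /asboolP[solS [ret2 _]].
  exists [ffun x => displacement solS (ord0 : biop_of s) x]; split; last first.
    by move=> x y; rewrite ffunE; apply/esym/(sigma_displacement solS ord0 x y).
  split=> x y; rewrite !ffunE; first exact: (displacement_commute solS ret2).
  congr (_ * _)%g; exact: (sigma_perm_displacement solS ret2 ord0).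
pose E : {set D} := [set L : D | `[< commuting_family L >]].
pose code (s : tables N) : {ffun 'I_N -> 'I_N} * D :=
  (s.1 ord0, odflt [ffun=> 1%g]
    [pick L in E | [forall x, forall y, s.1 x y == s.1 ord0 (L x y)]]).
have codeP s : s \in mp_tables N 2 ->
    (code s).2 \in E /\ forall x y, s.1 x y = s.1 ord0 ((code s).2 x y).
  move=> /dec[L [cL sL]]; rewrite /code /=; case: pickP => [L' /andP[L'E] |/(_ L)].
    by move=> /forallP h; split=> // x y; apply/eqP; apply: (forallP (h x)).
  rewrite inE; case/negP; apply/andP; split; first exact/asboolP.
  by apply/forallP => x; apply/forallP => y; rewrite -sL.
rewrite -(card_in_imset (f := code)); last first.
  move=> [s1 s2] [s1' s2'] sT sT'.
  have [_ h] := codeP _ sT; have [_ h'] := codeP _ sT' => eqc.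
  have eq1 : s1 = s1'.
    apply/ffunP => x; apply/ffunP => y; rewrite [LHS]h [RHS]h' -eqc.
    by case: eqc => /= ->.
  (* Involutivity recovers tau from sigma. *)
  subst s1'; congr (_, _); apply/ffunP => x; apply/ffunP => y.
  move: sT sT'; rewrite !inE => /asboolP[solS _] /asboolP[solS' _].
  apply: (bij_inj ((sol_nondegenerate solS).1 (s1 x y))).
  exact: etrans (involutive_tau solS x y) (esym (involutive_tau solS' x y)).
apply: leq_trans (_ : #|setX [set: {ffun 'I_N -> 'I_N}] E| <= _).
  apply/subset_leq_card/subsetP => _ /imsetP[s sT ->].
  by rewrite !inE /=; have [+ _] := codeP s sT; rewrite inE.
rewrite cardsX cardsT card_ffun card_ord leq_mul2l; apply/orP; right.
by have := @card_commuting_family 'I_N; rewrite card_ord.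
Qed.

Lemma mp_count2_le n (l := (trunc_log 2 n).+1) :
  mp_count n 2 <= 2 ^ (l * l.+1 * n + n ^ 2 %/ 4).
Proof.
apply: leq_trans (mp_count_le n 2) _; apply: leq_trans (card_mp_tables2 n) _.
rewrite mulnA -expnD -mulnS expnD leq_mul2r; apply/orP; right.
apply: leq_trans (_ : (2 ^ l) ^ (n * l.+1) <= _).
  have [->|n0] := posnP n; first by rewrite mul0n.
  by rewrite leq_exp2r ?muln_gt0 ?n0 // ltnW // trunc_log_ltn.
by rewrite -expnM mulnA mulnAC.
Qed.

(** The constant 10 is attained at m = 3, where the maximum of
    (m+1)^2 (m+2) / 2^m is 80/8. From there on the left-hand side at most doubles
    when m increases by 1. *)
Lemma cubic_le_exp m : m.+1 ^ 2 * m.+2 <= 10 * 2 ^ m.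
Proof.
have [small|] := leqP m 3; first by case: m small => [|[|[|[]]]].
elim: m => // m IHm; rewrite ltnS leq_eqVlt => /orP[/eqP <- //|lem].
have {}IHm := IHm lem.
rewrite (expnS 2) mulnCA; apply: leq_trans (_ : 2 * (m.+1 ^ 2 * m.+2) <= _); last first.
  by rewrite leq_mul2l.
nia.
Qed.

(** * The asymptotic bound *)

From mathcomp Require Import all_classical all_reals all_analysis.
Import Order.TTheory GRing.Theory Num.Theory numFieldNormedType.Exports.
Local Open Scope classical_set_scope.
Local Open Scope ring_scope.

Lemma trunc_log2_cvgn : trunc_log 2 n @[n --> \oo] --> \oo.
Proof.
move=> A [N _ NA]; exists (2 ^ N)%N => // n /= len; apply: NA => /=.
exact: trunc_log_max.
Qed.

Theorem theorem8p4 : forall R : realType,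
  exists2 e : nat -> R,
    e n @[n --> \oo] --> (0 : R) &
    forall n : nat,
      (mp_count n 2)%:R <= (2 : R) `^ ((4^-1 + e n) * n%:R ^+ 2).
Proof.
(* With l = trunc_log 2 n + 1, the error is 10/l. For n > 0 it has to be at
   least l(l+1)/n, and l^2 (l+1) <= 10 * 2^(l-1) <= 10 n. *)
move=> R; exists (fun n => 10 * harmonic (trunc_log 2 n)).
  rewrite -[X in _ --> X](mulr0 10); apply: cvgMr.
  exact: (cvg_comp _ _ trunc_log2_cvgn cvg_harmonic).
move=> n; set m := trunc_log 2 n.
apply: (@le_trans _ _ (2 `^ (m.+1 * m.+2 * n + n ^ 2 %/ 4)%:R)).
  by rewrite powR_mulrn // -natrX ler_nat mp_count2_le.
apply: ler_powR; first by rewrite ler1n.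
rewrite natrD addrC mulrDl lerD //.
  rewrite -natrX mulrC ler_pdivlMr // -natrM ler_nat; exact: leq_trunc_div.
have [->|n0] := posnP n; first by rewrite muln0 expr0n mulr0.
rewrite /harmonic mulrAC ler_pdivlMr ?ltr0n // -natrX -!natrM ler_nat.
have le2 := trunc_logP (isT : 1 < 2)%N n0; rewrite -/m in le2.
have := cubic_le_exp m; nia.
Qed.
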